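(* Let $A$ be a nonempty set, let $\mathcal{O}\subseteq\mathbb{R}^n$ be open, and let $\sigma\colon \mathcal{O}\times A\to\mathbb{R}^{n\times m}$, $\beta\colon\mathcal{O}\times A\to\mathbb{R}^n$, $g,\rho\colon\mathcal{O}\times A\to\mathbb{R}$ be arbitrary functions. Define, for $a\in A$, $x\in\mathcal{O}$, $r\in\mathbb{R}$, $p\in\mathbb{R}^n$, $P\in\mathcal{S}_n$, $$\mathcal{L}(a,x,r,p,P):=g(x,a)+\langle\beta(x,a),p\rangle+\tfrac12\operatorname{Tr}\big(\sigma(x,a)\sigma^*(x,a)P\big)-\rho(x,a)r,\qquad \mathcal{H}(x,r,p,P):=\sup_{a\in A}\mathcal{L}(a,x,r,p,P).$$ Let $v\colon\mathcal{O}\to\mathbb{R}$ be locally semiconvex and a viscosity supersolution at each $x\in\mathcal{O}$ of $\mathcal{H}(x,v(x),Dv(x),D^2v(x))=0$. For $x\in\mathcal{O}$ let $R(x):=\operatorname{Span}\{\operatorname{range}(\sigma(x,a))\colon a\in A\}$. (i) Let $x\in\mathcal{O}$ with $R(x)\neq\{0\}$. Then $v$ is differentiable at $x$ along the subspace $R(x)$ (i.e. $D_{R(x)}v(x)\neq\emptyset$), and $$D_{R(x)}v(x)=P_{R(x)}D^-v(x).$$ (ii) Let $\mathcal{D}\subseteq\mathcal{O}$ be open and let $\{S(x)\}_{x\in\mathcal{D}}$ be a family of non-trivial linear subspaces of $\mathbb{R}^n$ with $S(x)\subseteq R(x)$ for every $x\in\mathcal{D}$, such that the map $\mathcal{D}\to\mathcal{L}(\mathbb{R}^n)$,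 $x\mapsto P_{S(x)}$, is continuous. Then the map $D_Sv\colon\mathcal{D}\to\mathbb{R}^n$, $x\mapsto D_{S(x)}v(x)$, is well-defined and continuous. In particular, if $R(x)=\mathbb{R}^n$ for all $x\in\mathcal{D}$, then $v\in C^1(\mathcal{D})$.
   Context: $\mathcal{S}_n$ is the set of real symmetric $n\times n$ matrices, $\mathcal{L}(\mathbb{R}^n)$ the set of linear operators on $\mathbb{R}^n$, $\operatorname{range}(\sigma)$ the range (column space) of a matrix $\sigma$, and $P_S$ the orthogonal projection of $\mathbb{R}^n$ onto a subspace $S$. For a subspace $S\subseteq\mathbb{R}^n$ and $x\in\mathcal{O}$: $D^-_Sv(x):=\{p\in S\colon \liminf_{y\to x,\ y\in(x+S)\cap\mathcal{O}}\frac{v(y)-v(x)-\langle p,y-x\rangle}{|y-x|}\ge0\}$ and $D_Sv(x):=\{p\in S\colon \lim_{y\to x,\ y\in(x+S)\cap\mathcal{O}}\frac{v(y)-v(x)-\langle p,y-x\rangle}{|y-x|}=0\}$; $D^-v(x):=D^-_{\mathbb{R}^n}v(x)$. If $D_Sv(x)$ is nonempty it is a singleton and is identified with its unique element; ''$v$ is differentiable at $x$ along $S$'' means $D_Sv(x)\ne\emptyset$. The identity $D_{R(x)}v(x)=P_{R(x)}D^-v(x)$ is an equality of sets (in particular the right side is a singleton). Local semiconvexity: for each $x_0\in\mathcal{O}$ there exist $R>0$ with $B_R(x_0)\subset\mathcal{O}$ and $c_R\ge0$ such that $v(\lambda x+(1-\lambda)y)-\lambda v(x)-(1-\lambda)v(y)\le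 c_R\lambda(1-\lambda)|x-y|^2$ for all $\lambda\in[0,1]$, $x,y\in B_R(x_0)$. Viscosity supersolution at $x\in\mathcal{O}$: $v$ is lower semicontinuous at $x$ and for every $\varphi\in C^2(\mathcal{O})$ such that $v-\varphi$ attains a local minimum at $x$, one has $-\mathcal{H}(x,v(x),D\varphi(x),D^2\varphi(x))\ge0$. *)

(* Defs.v *)
From HB Require Import structures.
From mathcomp Require Import all_boot all_order all_algebra.
From mathcomp Require Import all_classical all_reals all_analysis.
Set Implicit Arguments. Unset Strict Implicit. Unset Printing Implicit Defensive.
Import Order.TTheory GRing.Theory Num.Theory.
Import numFieldNormedType.Exports.
Local Open Scope classical_set_scope.
Local Open Scope ring_scope.

Section Defs.
Variables (R : realType) (n : nat).
Implicit Types (u w x y p : 'rV[R]_n).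

Definition dotv u w : R := (u *m w^T) 0 0.
Definition enorm u : R := Num.sqrt (dotv u u).
Definition eball (x0 : 'rV[R]_n) (r : R) : set 'rV[R]_n :=
  [set y | enorm (y - x0) < r].

Definition lin_subspace (S : set 'rV[R]_n) : Prop :=
  S 0 /\ (forall u w, S u -> S w -> S (u + w)) /\
  (forall (c : R) u, S u -> S (c *: u)).
Definition nontrivial (S : set 'rV[R]_n) : Prop := exists u, S u /\ u != 0.

Definition is_proj (S : set 'rV[R]_n) u q : Prop :=
  S q /\ forall s, S s -> dotv (u - q) s = 0.

Definition Dsub_minus (S : set 'rV[R]_n) (O : set 'rV[R]_n)
  (v : 'rV[R]_n -> R) x : set 'rV[R]_n :=
  [set p | S p /\ forall e : R, 0 < e ->
     \forall y \near x, O y -> S (y - x) ->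
        - (e * enorm (y - x)) <= v y - v x - dotv p (y - x)].

Definition Dsub (S : set 'rV[R]_n) (O : set 'rV[R]_n)
  (v : 'rV[R]_n -> R) x : set 'rV[R]_n :=
  [set p | S p /\ forall e : R, 0 < e ->
     \forall y \near x, O y -> S (y - x) ->
        `|v y - v x - dotv p (y - x)| <= e * enorm (y - x)].

Definition Dminus (O : set 'rV[R]_n) (v : 'rV[R]_n -> R) x :=
  Dsub_minus setT O v x.

Definition has_grad (f : 'rV[R]_n -> R) x p : Prop :=
  forall e : R, 0 < e -> \forall y \near x,
    `|f y - f x - dotv p (y - x)| <= e * enorm (y - x).

Definition has_jac (F : 'rV[R]_n -> 'rV[R]_n) x (M : 'M[R]_n) : Prop :=
  forall e : R, 0 < e -> \forall y \near x,
    enorm (F y - F x - (y - x) *m M) <= e * enorm (y - x).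

Definition C2_with (O : set 'rV[R]_n) (phi : 'rV[R]_n -> R)
  (Dphi : 'rV[R]_n -> 'rV[R]_n) (D2phi : 'rV[R]_n -> 'M[R]_n) : Prop :=
  (forall x, O x -> has_grad phi x (Dphi x) /\ has_jac Dphi x (D2phi x)) /\
  {within O, continuous D2phi}.

Definition C1_on (D : set 'rV[R]_n) (f : 'rV[R]_n -> R) : Prop :=
  exists Df : 'rV[R]_n -> 'rV[R]_n,
    (forall x, D x -> has_grad f x (Df x)) /\ {within D, continuous Df}.

Definition loc_semiconvex (O : set 'rV[R]_n) (v : 'rV[R]_n -> R) : Prop :=
  forall x0, O x0 -> exists r : R, exists c : R,
    0 < r /\ 0 <= c /\ eball x0 r `<=` O /\
    forall (l : R) x y, 0 <= l <= 1 -> eball x0 r x -> eball x0 r y ->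
      v (l *: x + (1 - l) *: y) - l * v x - (1 - l) * v y
        <= c * l * (1 - l) * (enorm (x - y)) ^+ 2.

Definition lsc_at (v : 'rV[R]_n -> R) x : Prop :=
  forall e : R, 0 < e -> \forall y \near x, v x - e < v y.

Definition loc_min_at (f : 'rV[R]_n -> R) x : Prop :=
  \forall y \near x, f x <= f y.

End Defs.

Section HJB.
Variables (R : realType) (n m : nat) (A : Type).
Variables (sigma : 'rV[R]_n -> A -> 'M[R]_(n, m))
          (beta : 'rV[R]_n -> A -> 'rV[R]_n)
          (g rho : 'rV[R]_n -> A -> R).

Definition Lag (a : A) (x : 'rV[R]_n) (r : R) (p : 'rV[R]_n) (P : 'M[R]_n) : R :=
  g x a + dotv (beta x a) p
  + 2^-1 * \tr (sigma x a *m (sigma x a)^T *m P) - rho x a * r.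

Definition Ham (x : 'rV[R]_n) (r : R) (p : 'rV[R]_n) (P : 'M[R]_n) : \bar R :=
  ereal_sup [set (Lag a x r p P)%:E | a in [set: A]].

Definition visc_super_at (O : set 'rV[R]_n) (v : 'rV[R]_n -> R) x : Prop :=
  lsc_at v x /\
  forall (phi : 'rV[R]_n -> R) (Dphi : 'rV[R]_n -> 'rV[R]_n)
         (D2phi : 'rV[R]_n -> 'M[R]_n),
    C2_with O phi Dphi D2phi -> loc_min_at (fun y => v y - phi y) x ->
    (0 <= - Ham x (v x) (Dphi x) (D2phi x))%E.

(* R(x) := Span { range(sigma(x,a)) : a in A }; range(sigma) as row vectors
   w *m sigma^T, w in R^m. *)
Definition Rspan (x : 'rV[R]_n) : set 'rV[R]_n :=
  [set u | exists (k : nat) (a : 'I_k -> A) (w : 'I_k -> 'rV[R]_m),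
     u = \sum_(i < k) w i *m (sigma x (a i))^T].

End HJB.

(* Main.v *)
Require Import Defs.
From HB Require Import structures.
From mathcomp Require Import all_boot all_order all_algebra.
From mathcomp Require Import all_classical all_reals all_analysis.
From mathcomp Require Import ring lra.
Import Order.TTheory GRing.Theory Num.Theory.
Import numFieldNormedType.Exports.
Local Open Scope classical_set_scope.
Local Open Scope ring_scope.
Set Implicit Arguments. Unset Strict Implicit.
Unset Printing Implicit Defensive.

(* A locally semiconvex v lies above the paraboloid
   v x + <p, h> - c |h|^2 for every p in D^-v(x).  If p1, p2 in D^-v(x) had
   different projections on the range of sigma(x, a), the maximum of two such
   paraboloids would be a convex kink that could be touched from below by
   smooth functions with arbitrarily large second derivative in that range,
   against the supersolution property.  Hence D^-v(x) has a single projection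
   on R(x).  Since subgradients are locally bounded and x |-> D^-v(x) has a
   closed graph, the projections of p in D^-v(y) tend to that of D^-v(x) as
   y -> x; comparing v x and v y through subgradients at both ends gives
   differentiability along subspaces of R(x), and continuity of D_S v. *)

(** * Euclidean inner product and norm *)

Section Euclid.
Variables (R : realType) (n : nat).
Implicit Types (u w x y p : 'rV[R]_n).

Lemma dotvE u w : dotv u w = \sum_i u 0 i * w 0 i.
Proof. by rewrite /dotv mxE; apply: eq_bigr => i _; rewrite mxE. Qed.

Lemma dotvC u w : dotv u w = dotv w u.
Proof. by rewrite !dotvE; apply: eq_bigr => i _; rewrite mulrC. Qed.

Lemma dotvDl u1 u2 w : dotv (u1 + u2) w = dotv u1 w + dotv u2 w.
Proof. by rewrite /dotv mulmxDl mxE. Qed.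

Lemma dotvZl (c : R) u w : dotv (c *: u) w = c * dotv u w.
Proof. by rewrite /dotv -scalemxAl mxE. Qed.

Lemma dotvNl u w : dotv (- u) w = - dotv u w.
Proof. by rewrite -scaleN1r dotvZl mulN1r. Qed.

Lemma dotvBl u1 u2 w : dotv (u1 - u2) w = dotv u1 w - dotv u2 w.
Proof. by rewrite dotvDl dotvNl. Qed.

Lemma dotvDr u w1 w2 : dotv u (w1 + w2) = dotv u w1 + dotv u w2.
Proof. by rewrite !(dotvC u) dotvDl. Qed.

Lemma dotvZr (c : R) u w : dotv u (c *: w) = c * dotv u w.
Proof. by rewrite !(dotvC u) dotvZl. Qed.

Lemma dotvNr u w : dotv u (- w) = - dotv u w.
Proof. by rewrite !(dotvC u) dotvNl. Qed.

Lemma dotvBr u w1 w2 : dotv u (w1 - w2) = dotv u w1 - dotv u w2.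
Proof. by rewrite dotvDr dotvNr. Qed.

Lemma dotv0l w : dotv 0 w = 0.
Proof. by rewrite /dotv mul0mx mxE. Qed.

Lemma dotv0r u : dotv u 0 = 0.
Proof. by rewrite dotvC dotv0l. Qed.

Lemma dotvv_ge0 u : 0 <= dotv u u.
Proof. by rewrite dotvE; apply: sumr_ge0 => i _; rewrite -expr2 sqr_ge0. Qed.

Lemma enorm_ge0 u : 0 <= enorm u.
Proof. exact: sqrtr_ge0. Qed.

Lemma sqr_enorm u : enorm u ^+ 2 = dotv u u.
Proof. by rewrite sqr_sqrtr ?dotvv_ge0. Qed.

Lemma enorm0 : enorm (0 : 'rV[R]_n) = 0.
Proof. by rewrite /enorm dotv0l sqrtr0. Qed.

Lemma enormZ (c : R) u : enorm (c *: u) = `|c| * enorm u.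
Proof.
by rewrite /enorm dotvZl dotvZr mulrA -expr2 sqrtrM ?sqr_ge0// sqrtr_sqr.
Qed.

Lemma enormN u : enorm (- u) = enorm u.
Proof. by rewrite /enorm dotvNl dotvNr opprK. Qed.

Lemma enormB u w : enorm (u - w) = enorm (w - u).
Proof. by rewrite -enormN opprB. Qed.

Lemma dotvv_eq0 u : dotv u u = 0 -> u = 0.
Proof.
rewrite dotvE => /eqP; rewrite psumr_eq0 => [/allP u0|i _]; last first.
  by rewrite -expr2 sqr_ge0.
apply/rowP => i; rewrite mxE; apply/eqP.
by have := u0 i; rewrite mem_index_enum -expr2 sqrf_eq0; apply.
Qed.

Lemma enorm_eq0 u : enorm u = 0 -> u = 0.
Proof. by move=> u0; apply: dotvv_eq0; rewrite -sqr_enorm u0 expr0n. Qed.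

(** Cauchy-Schwarz: the squared norm of |w| u - |u| w is nonnegative and equals 2 |u| |w| (|u| |w| -
    <u, w>). *)
Lemma dotv_le_enorm u w : dotv u w <= enorm u * enorm w.
Proof.
have [w0|w0] := eqVneq (enorm w) 0.
  by rewrite w0 mulr0 (enorm_eq0 w0) dotv0r.
have w_gt0 : 0 < enorm w by rewrite lt_def w0 enorm_ge0.
have [u0|u0] := eqVneq (enorm u) 0.
  by rewrite u0 mul0r (enorm_eq0 u0) dotv0l.
have u_gt0 : 0 < enorm u by rewrite lt_def u0 enorm_ge0.
have := dotvv_ge0 (enorm w *: u - enorm u *: w).
rewrite !(dotvBl, dotvBr, dotvZl, dotvZr) (dotvC w u) -!sqr_enorm.
rewrite [leRHS](_ : _ =
  2 * (enorm u * enorm w) * (enorm u * enorm w - dotv u w)); last by ring.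
by rewrite pmulr_rge0 ?subr_ge0// !mulr_gt0.
Qed.

Lemma norm_dotv_le u w : `|dotv u w| <= enorm u * enorm w.
Proof.
rewrite ler_norml dotv_le_enorm andbT.
by have := dotv_le_enorm (- u) w; rewrite dotvNl enormN; lra.
Qed.

Lemma enormD u w : enorm (u + w) <= enorm u + enorm w.
Proof.
rewrite -(@ler_pXn2r _ 2) ?nnegrE ?addr_ge0 ?enorm_ge0//.
rewrite sqrrD !sqr_enorm dotvDl !dotvDr (dotvC w u).
by have := dotv_le_enorm u w; lra.
Qed.

Lemma enorm_triangle x y z : enorm (x - z) <= enorm (x - y) + enorm (y - z).
Proof. by have := enormD (x - y) (y - z); rewrite addrA subrK. Qed.

Lemma mx_entry_le (k l : nat) (M : 'M[R]_(k, l)) i j : `|M i j| <= `|M|.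
Proof.
rewrite [leRHS]mx_normrE.
exact: (le_bigmax _ (fun ij => `|M ij.1 ij.2|) (i, j)).
Qed.

Lemma norm_le_enorm u : `|u| <= enorm u.
Proof.
rewrite [leLHS]mx_normrE; apply: bigmax_le; first exact: enorm_ge0.
move=> [i j] _ /=; rewrite ord1 -sqrtr_sqr ler_sqrt ?sqr_ge0 ?dotvv_ge0//.
rewrite dotvE (bigD1 j)//= expr2 lerDl; apply: sumr_ge0 => k _.
by rewrite -expr2 sqr_ge0.
Qed.

(** The norm on the right is the maximum norm. The factor [n.+1], cruder than sqrt n, stays positive
    for n = 0 and can thus serve as a divisor. *)
Lemma enorm_le_norm u : enorm u <= n.+1%:R * `|u|.
Proof.
rewrite -(@ler_pXn2r _ 2) ?nnegrE ?mulr_ge0 ?enorm_ge0//.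
rewrite sqr_enorm dotvE.
apply: (@le_trans _ _ (\sum_(i < n) `|u| ^+ 2)).
  apply: ler_sum => i _; rewrite -expr2 -real_normK ?num_real//.
  by rewrite ler_pXn2r ?nnegrE// mx_entry_le.
rewrite sumr_const card_ord -[leLHS]mulr_natl exprMn ler_wpM2r ?sqr_ge0//.
by rewrite -natrX ler_nat (leq_trans (leqnSn n))// leq_pmulr.
Qed.

Lemma enorm_mulmx_le u (M : 'M[R]_n) :
  enorm (u *m M) <= n.+1%:R ^+ 2 * `|M| * enorm u.
Proof.
apply: (le_trans (enorm_le_norm _)); rewrite expr2 -!mulrA ler_wpM2l//.
have H : 0 <= n.+1%:R * (`|M| * enorm u) by rewrite !mulr_ge0 ?enorm_ge0.
rewrite [leLHS]mx_normrE; apply: bigmax_le => // -[i j] _ /=.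
rewrite mxE; apply: (le_trans (ler_norm_sum _ _ _)).
apply: (@le_trans _ _ (\sum_(k < n) `|M| * enorm u)).
  apply: ler_sum => k _; rewrite normrM mulrC ler_pM ?mx_entry_le//.
  exact: le_trans (mx_entry_le _ _ _) (norm_le_enorm u).
rewrite sumr_const card_ord -[leLHS]mulr_natl ler_wpM2r ?ler_nat ?leqnSn//.
by rewrite mulr_ge0 ?enorm_ge0.
Qed.

(** * Neighbourhoods and compactness in Euclidean terms *)

Lemma nbhs_enormP x (P : set 'rV[R]_n) :
  (\forall y \near x, P y) <->
  exists2 d : R, 0 < d & forall y, enorm (y - x) < d -> P y.
Proof.
split=> [/nbhs_ballP[d /= d0 dP]|[d d0 dP]].
  exists d => // y yx; apply: dP; rewrite -ball_normE /= distrC.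
  exact: le_lt_trans (norm_le_enorm _) yx.
apply/nbhs_ballP; exists (d / n.+1%:R) => /=; first by rewrite divr_gt0.
move=> y; rewrite -ball_normE /= distrC ltr_pdivlMr// mulrC => yx.
by apply: dP; exact: le_lt_trans (enorm_le_norm _) yx.
Qed.

Lemma open_eball (O : set 'rV[R]_n) x : open O -> O x ->
  exists2 d : R, 0 < d & forall y, enorm (y - x) < d -> O y.
Proof. by move=> oO Ox; apply/nbhs_enormP; exact: open_nbhs_nbhs. Qed.

(** The closed ball lies in a product of segments, which is compact. *)
Lemma eball_cluster x (d : R) (F : set_system 'rV[R]_n) : ProperFilter F ->
  F [set y | enorm (y - x) <= d] ->
  exists2 y, enorm (y - x) <= d & forall B (e : R), F B -> 0 < e ->
    exists2 z, B z & enorm (z - y) < e.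
Proof.
move=> FF Fd.
have cB := @rV_compact R n (fun i => `[x 0 i - d, x 0 i + d]%classic)
  (fun i => @segment_compact _ _ _).
have [|y [_ yF]] := cB F FF.
  apply: filterS Fd => z /= zd i /=; rewrite in_itv /= -ler_distlC.
  have := le_trans (mx_entry_le (z - x) 0 i) (le_trans (norm_le_enorm _) zd).
  by rewrite !mxE distrC.
have yc B (e : R) : F B -> 0 < e -> exists2 z, B z & enorm (z - y) < e.
  move=> FB e0; have /(_ B [set z | enorm (z - y) < e] FB) := yF.
  by case=> [|z [Bz ze]]; [apply/nbhs_enormP; exists e | exists z].
exists y => //; apply/ler_addgt0Pr => e e0; have [z /= zd zy] := yc _ e Fd e0.
have := enorm_triangle y z x; rewrite (enormB y z) => yzx.
lra.
Qed.

(** The sublevel sets [B z] are nested, hence generate a filter. By lower semicontinuity, f at a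
    cluster point is at most f z for every z in the ball. *)
Lemma lsc_min_eball (f : 'rV[R]_n -> R) x (d : R) : 0 <= d ->
  (forall y, enorm (y - x) <= d -> lsc_at f y) ->
  exists2 y, enorm (y - x) <= d & forall z, enorm (z - x) <= d -> f y <= f z.
Proof.
move=> d0 lf; set K := [set y | enorm (y - x) <= d].
have Kx : K x by rewrite /K /= subrr enorm0.
pose B z := [set y | K y /\ f y <= f z].
have FF : ProperFilter (filter_from K B).
  apply: filter_from_proper; last by move=> z Kz; exists z; split.
  apply: filter_from_filter; first by exists x.
  move=> z1 z2 K1 K2; have [z12|z21] := leP (f z1) (f z2).
    by exists z1 => // y [Ky y1]; split; split=> //; exact: le_trans z12.
  by exists z2 => // y [Ky y1]; split; split=> //; apply: le_trans (ltW z21).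
have FK : filter_from K B K by exists x => // y [].
have [y yd yB] := eball_cluster FF FK.
exists y => // z Kz; apply/ler_addgt0Pr => e e0.
have /nbhs_enormP[r r0 ry] := lf y yd e e0.
have [|t [_ tz] ty] := yB (B z) r _ r0; first by exists z.
by have := ry t ty; lra.
Qed.

(** * Orthogonal projections onto subspaces *)

Lemma lin_subspace_proj (S : set 'rV[R]_n) : lin_subspace S ->
  exists P : 'M[R]_n, forall u, is_proj S u (u *m P).
Proof.
move=> [S0 [SD SZ]].
(* A maximal orthonormal system of vectors of S, the rows of B, spans S, and
   the projection matrix is then B^T *m B. *)
pose Q k := `[< exists2 B : 'M[R]_(k, n), B *m B^T = 1%:M &
  forall w : 'rV[R]_k, S (w *m B) >].
have Q0 : exists k, Q k.
  exists 0; apply/asboolP; exists 0; first by rewrite !flatmx0.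
  by move=> w; rewrite mulmx0.
(* Orthonormal rows have full rank, so there are at most n of them. *)
have Qn k : Q k -> (k <= n)%N.
  move=> /asboolP[B BB _]; have : \rank (B *m B^T) = k by rewrite BB mxrank1.
  by move=> <-; exact: leq_trans (mxrankM_maxl _ _) (rank_leq_col _).
have [k /asboolP[B BB SB] kmax] := ex_maxnP Q0 Qn.
have key s : S s -> s = s *m B^T *m B.
  move=> Ss; apply/eqP; rewrite -subr_eq0; apply/eqP/enorm_eq0.
  set r := s - _; apply/eqP/contraT => r0.
  have Sr : S r.
    by apply: SD => //; rewrite -scaleN1r; apply: SZ; exact: SB.
  have rB : r *m B^T = 0 by rewrite mulmxBl -!mulmxA BB mulmx1 subrr.
  (* Normalising the residual [r] and stacking it on [B] would give k + 1 orthonormal rows, against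
     maximality. *)
  pose c := (enorm r)^-1.
  have : Q (1 + k)%N.
    apply/asboolP; exists (col_mx (c *: r) B).
      rewrite tr_col_mx mul_col_row BB linearZ /= -!scalemxAl -!scalemxAr.
      rewrite rB scaler0 -[B *m r^T]trmxK trmx_mul trmxK rB trmx0 scaler0.
      have -> : r *m r^T = (enorm r ^+ 2)%:M.
        by rewrite sqr_enorm [LHS]mx11_scalar.
      rewrite scalerA scale_scalar_mx -expr2 -exprMn mulVf// expr1n.
      by rewrite -scalar_mx_block.
    move=> w; rewrite -[w]hsubmxK mul_row_col; apply: SD => //.
    by rewrite (mx11_scalar (lsubmx w)) mul_scalar_mx; apply/SZ/SZ.
  by move=> /kmax; rewrite ltnn.
exists (B^T *m B) => u; split=> [|s Ss]; first by rewrite mulmxA; exact: SB.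
have o : (u - u *m B^T *m B) *m B^T = 0.
  by rewrite mulmxBl -!mulmxA BB mulmx1 subrr.
by rewrite (key s Ss) /dotv trmx_mul !mulmxA o mul0mx mxE.
Qed.

Lemma lin_subspaceB (S : set 'rV[R]_n) u w :
  lin_subspace S -> S u -> S w -> S (u - w).
Proof.
by move=> [_ [SD SZ]] Su Sw; apply: SD => //; rewrite -scaleN1r; exact: SZ.
Qed.

Lemma is_proj_uniq (S : set 'rV[R]_n) u q1 q2 :
  lin_subspace S -> is_proj S u q1 -> is_proj S u q2 -> q1 = q2.
Proof.
move=> lS [S1 o1] [S2 o2]; apply/eqP; rewrite -subr_eq0; apply/eqP.
have S12 := lin_subspaceB lS S1 S2.
apply: dotvv_eq0; have := o1 _ S12; have := o2 _ S12.
by rewrite !dotvBl; lra.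
Qed.

End Euclid.

(** * Subgradients of semiconvex functions *)

Section Semiconvex.
Variables (R : realType) (n : nat).
Implicit Types (x y z p : 'rV[R]_n) (O : set 'rV[R]_n) (v : 'rV[R]_n -> R).

Lemma enorm_convex (l : R) x y z : 0 <= l <= 1 ->
  enorm (l *: y + (1 - l) *: z - x) <=
  l * enorm (y - x) + (1 - l) * enorm (z - x).
Proof.
move=> /andP[l0 l1].
have -> : l *: y + (1 - l) *: z - x = l *: (y - x) + (1 - l) *: (z - x).
  by apply/rowP => i; rewrite !mxE; ring.
by apply: le_trans (enormD _ _) _; rewrite !enormZ !ger0_norm ?subr_ge0.
Qed.

Lemma eball_convex (l r : R) x y z : 0 <= l <= 1 ->
  eball x r y -> eball x r z -> eball x r (l *: y + (1 - l) *: z).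
Proof.
rewrite /eball /= => l01 yr zr; apply: le_lt_trans (enorm_convex _ _ _ l01) _.
case/andP: l01 => l0 l1; have [l_lt1|l_ge1] := ltP l 1.
  have : l * enorm (y - x) <= l * r by apply: ler_wpM2l => //; exact: ltW.
  have : (1 - l) * enorm (z - x) < (1 - l) * r by rewrite ltr_pM2l//; lra.
  lra.
have -> : l = 1 by lra.
by rewrite mul1r subrr mul0r addr0.
Qed.

Definition semiconvex_on (B : set 'rV[R]_n) (c : R) v :=
  forall (l : R) x y, 0 <= l <= 1 -> B x -> B y ->
    v (l *: x + (1 - l) *: y) - l * v x - (1 - l) * v y
      <= c * l * (1 - l) * (enorm (x - y)) ^+ 2.

(** The subgradient inequality holds near y only. Applied at y + t h on the segment to z and
    compared with semiconvexity there, it yields, after division by t, a bound at z itself. *)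
Lemma semiconvex_le O v x (r c : R) p y z :
  open O -> 0 <= c -> eball x r `<=` O -> semiconvex_on (eball x r) c v ->
  eball x r y -> eball x r z -> Dminus O v y p ->
  v y + dotv p (z - y) - c * enorm (z - y) ^+ 2 <= v z.
Proof.
move=> oO c0 rO scv yr zr [_ py]; set h := z - y; set N := enorm h.
have N0 : 0 <= N by exact: enorm_ge0.
apply/ler_addgt0Pr => e e0.
have e'0 : 0 < e / (N + 1) by rewrite divr_gt0// ltr_wpDl.
have [d d0 dP] := (nbhs_enormP _ _).1 (py _ e'0).
have [d1 d10 dO] := open_eball oO (rO _ yr).
(* [t] is small enough for y + t h to lie in O and in the range of the subgradient estimate; N + 1
   avoids dividing by zero. *)
pose m := Num.min d d1; pose t := Num.min 1 (m / (N + 1)).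
have m0 : 0 < m by rewrite lt_min d0.
have t0 : 0 < t by rewrite lt_min ltr01 divr_gt0// ltr_wpDl.
have t1 : t <= 1 by rewrite ge_min lexx.
have tN : t * N < m.
  apply: (@lt_le_trans _ _ (t * (N + 1))); first by rewrite ltr_pM2l// ltrDl.
  by rewrite -ler_pdivlMr ?ge_min ?lexx ?orbT// ltr_wpDl.
have t01 : 0 <= t <= 1 by rewrite ltW.
have := scv t z y t01 zr yr.
have -> : t *: z + (1 - t) *: y = y + t *: h.
  by apply/rowP => i; rewrite !mxE; ring.
have yh : enorm (y + t *: h - y) = t * N.
  by rewrite addrAC subrr add0r enormZ gtr0_norm.
have [md md1] : m <= d /\ m <= d1 by rewrite !ge_min !lexx orbT.
have yd : enorm (y + t *: h - y) < d by rewrite yh (lt_le_trans tN).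
have := dP _ yd (dO _ _) I; rewrite yh => /(_ (lt_le_trans tN md1)).
rewrite [_ + _ - y]addrAC subrr add0r dotvZr -/h -/N => H1 H2.
have H3 :
    t * (v y + dotv p h - e / (N + 1) * N - c * (1 - t) * N ^+ 2) <= t * v z.
  by rewrite mulrBr mulrBr mulrDr; lra.
rewrite ler_pM2l// in H3.
have : e / (N + 1) * N <= e.
  by rewrite mulrAC ler_pdivrMr ?ltr_wpDl// mulrDr mulr1 lerDl ltW.
have : c * (1 - t) * N ^+ 2 <= c * N ^+ 2.
  rewrite ler_wpM2r ?sqr_ge0// ler_piMr//; lra.
lra.
Qed.

(** Converse of the paraboloid bound: the quadratic term is o(|z - y|). *)
Lemma quad_le_Dminus O v y p (C d : R) : 0 < d ->
  (forall z, enorm (z - y) < d ->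
    v y + dotv p (z - y) - C * enorm (z - y) ^+ 2 <= v z) ->
  Dminus O v y p.
Proof.
move=> d0 dP; split=> // e e0; apply/nbhs_enormP.
have C1 : 0 < `|C| + 1 by rewrite ltr_wpDl.
exists (Num.min d (e / (`|C| + 1))); first by rewrite lt_min d0 divr_gt0.
move=> z; rewrite lt_min ltr_pdivlMr// => /andP[zd ze] _ _.
have := dP z zd; set N := enorm _ => H.
have N0 : 0 <= N by exact: enorm_ge0.
have : C * N ^+ 2 <= (N * (`|C| + 1)) * N.
  rewrite expr2 mulrA ler_wpM2r// mulrC ler_wpM2l//.
  by have := ler_norm C; lra.
have : (N * (`|C| + 1)) * N <= e * N by rewrite ler_wpM2r// ltW.
lra.
Qed.

(** Points between x - d u and x + d u are convex combinations of these endpoints, so semiconvexity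
    bounds v there by its two endpoint values. *)
Lemma semiconvex_line_bounded v x (r c : R) u : 0 < r -> 0 <= c ->
  semiconvex_on (eball x r) c v ->
  exists (d M : R), 0 < d /\ forall s, `|s| <= d ->
    eball x r (x + s *: u) /\ v (x + s *: u) <= M.
Proof.
move=> r0 c0 scv; have u1 : 0 < enorm u + 1 by rewrite ltr_wpDl ?enorm_ge0.
pose d := r / 2 / (enorm u + 1).
have d0 : 0 < d by rewrite !divr_gt0.
have du : d * enorm u < r / 2.
  by rewrite mulrAC ltr_pdivrMr// ltr_pM2l ?divr_gt0// ltrDl.
clearbody d; have B s : `|s| <= d -> eball x r (x + s *: u).
  move=> sd; rewrite /eball /= addrAC subrr add0r enormZ.
  have : `|s| * enorm u <= d * enorm u by rewrite ler_wpM2r ?enorm_ge0.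
  lra.
have Bd : eball x r (x + d *: u) by apply: B; rewrite gtr0_norm.
have BNd : eball x r (x + (- d) *: u) by apply: B; rewrite normrN gtr0_norm.
exists d, (`|v (x + d *: u)| + `|v (x + (- d) *: u)| + c * r ^+ 2).
split=> // s sd; split; first exact: B.
move: sd; rewrite ler_norml => /andP[sd1 sd2].
pose l := (s + d) / (2 * d).
have d2 : 0 < 2 * d by rewrite mulr_gt0.
have l01 : 0 <= l <= 1.
  by rewrite divr_ge0 ?(ltW d2)//= ?ler_pdivrMr//; lra.
have := scv l _ _ l01 Bd BNd.
have -> : l *: (x + d *: u) + (1 - l) *: (x + - d *: u) = x + s *: u.
  by apply/rowP => i; rewrite !mxE /l; field; rewrite gt_eqF.
have -> : x + d *: u - (x + - d *: u) = (2 * d) *: u.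
  by apply/rowP => i; rewrite !mxE; ring.
rewrite enormZ gtr0_norm//.
set a := v _; set a1 := v _; set a2 := v _; set N := 2 * d * enorm u.
have N0 : 0 <= N by rewrite mulr_ge0 ?enorm_ge0// ltW.
have /andP[l0 l1] := l01; clearbody l; have Nr : N ^+ 2 <= r ^+ 2.
  have Nr : N <= r by rewrite /N -mulrA; lra.
  by rewrite ler_pXn2r ?nnegrE ?(ltW r0).
have : c * l * (1 - l) * N ^+ 2 <= c * r ^+ 2.
  have ? : 0 <= c * l * (1 - l) by rewrite mulr_ge0 ?subr_ge0 ?mulr_ge0.
  apply: ler_pM => //; first exact: sqr_ge0.
  by rewrite -mulrA ler_piMr// mulr_ile1 ?subr_ge0// gerBl.
have : l * a1 <= `|a1|.
  by apply: le_trans (ler_norm _) _; rewrite normrM ler_piMl// ger0_norm; lra.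
have : (1 - l) * a2 <= `|a2|.
  by apply: le_trans (ler_norm _) _; rewrite normrM ler_piMl// ger0_norm; lra.
lra.
Qed.

(** Induction on the coordinates: a displacement along i :: s is the midpoint of the doubled
    displacements along i and along s. *)
Lemma semiconvex_box_bounded v x (r c : R) (s : seq 'I_n) : 0 < r -> 0 <= c ->
  semiconvex_on (eball x r) c v ->
  exists (d M : R), 0 < d /\ forall h : 'rV[R]_n, (forall i, `|h 0 i| <= d) ->
    let y := x + \sum_(i <- s) h 0 i *: delta_mx 0 i : 'rV[R]_n in
    eball x r y /\ v y <= M.
Proof.
move=> r0 c0 scv; elim: s => [|i s [d1 [M1 [d10 IH]]]].
  exists 1, (v x); split=> // h _ /=; rewrite big_nil addr0; split=> //.
  by rewrite /eball /= subrr enorm0.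
have [d2 [M2 [d20 L]]] := semiconvex_line_bounded (delta_mx 0 i) r0 c0 scv.
(* The radius is halved because h gets doubled; c r^2 is the semiconvexity error c (1/4) (2 r)^2 at
   a midpoint. *)
exists (Num.min d1 d2 / 2), (2^-1 * M1 + 2^-1 * M2 + c * r ^+ 2).
split; first by rewrite divr_gt0// lt_min d10.
move=> h hd /=; rewrite big_cons.
have hd' j : `|(2 *: h) 0 j| <= Num.min d1 d2.
  by rewrite mxE normrM ger0_norm// mulrC -ler_pdivlMr.
have [|B1 V1] := IH (2 *: h).
  by move=> j; apply: le_trans (hd' j) _; rewrite ge_min lexx.
have [|B2 V2] := L ((2 *: h) 0 i).
  by apply: le_trans (hd' i) _; rewrite ge_min lexx orbT.
set y1 := x + \sum_(_ <- s) _ in B1 V1; set y2 := x + _ in B2 V2.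
have l01 : 0 <= (2^-1 : R) <= 1 by apply/andP; split; lra.
have -> : x + (h 0 i *: delta_mx 0 i + \sum_(j <- s) h 0 j *: delta_mx 0 j) =
    2^-1 *: y1 + (1 - 2^-1) *: y2.
  have -> : \sum_(j <- s) h 0 j *: delta_mx 0 j =
      2^-1 *: \sum_(j <- s) (2 *: h) 0 j *: delta_mx 0 j :> 'rV_n.
    rewrite scaler_sumr; apply: eq_bigr => j _; rewrite mxE scalerA mulrA.
    by rewrite mulVf// mul1r.
  rewrite /y1 /y2; set w := \sum_(_ <- _) _.
  by apply/rowP => j; rewrite !mxE; field.
split; first exact: eball_convex.
have := scv _ _ _ l01 B1 B2.
have : enorm (y1 - y2) ^+ 2 <= (2 * r) ^+ 2.
  rewrite ler_pXn2r ?nnegrE ?enorm_ge0// ?mulr_ge0 ?(ltW r0)//.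
  have := enorm_triangle y1 x y2; rewrite (enormB x).
  move: B1 B2; rewrite /eball /=; lra.
set N := _ ^+ 2 => HN.
have : c * 2^-1 * (1 - 2^-1) * N <= c * 2^-1 * (1 - 2^-1) * (2 * r) ^+ 2.
  by rewrite ler_wpM2l// !mulr_ge0//; lra.
rewrite exprMn; lra.
Qed.

Lemma semiconvex_bounded v x (r c : R) : 0 < r -> 0 <= c ->
  semiconvex_on (eball x r) c v ->
  exists (d M : R), 0 < d /\ forall y, enorm (y - x) < d -> v y <= M.
Proof.
move=> r0 c0 scv.
have [d [M [d0 H]]] := semiconvex_box_bounded (index_enum 'I_n) r0 c0 scv.
exists d, M; split=> // y yx; have := H (y - x); rewrite -row_sum_delta.
rewrite addrCA subrr addr0; case=> // i; apply: le_trans (mx_entry_le _ _ _) _.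
exact: le_trans (norm_le_enorm _) (ltW yx).
Qed.

(** Moving from y by a step of length d in the direction of p raises the paraboloid to v y + d |p| -
    c d^2. The upper bound on v there and the lower bound on v y from semicontinuity then bound
    |p|. *)
Lemma Dminus_local O v x : open O -> loc_semiconvex O v -> O x -> lsc_at v x ->
  exists d c M : R, [/\ 0 < d, 0 <= c, 0 <= M, eball x d `<=` O &
    forall y p, eball x d y -> Dminus O v y p -> enorm p <= M /\
      forall z, eball x d z ->
        v y + dotv p (z - y) - c * enorm (z - y) ^+ 2 <= v z].
Proof.
move=> oO scv Ox /(_ 1 ltr01)/nbhs_enormP[d2 d20 lo].
have [r [c [r0 [c0 [rO {}scv]]]]] := scv x Ox.
have [d1 [M1 [d10 up]]] := semiconvex_bounded r0 c0 scv.
(* Halving keeps y + h in the ball of radius 2 d, where all three estimates hold, when |y - x| < d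
   and |h| = d. *)
pose d := Num.min r (Num.min d1 d2) / 2.
have d0 : 0 < d by rewrite divr_gt0// !lt_min r0 d10.
have [dr [dd1 dd2]] : 2 * d <= r /\ 2 * d <= d1 /\ 2 * d <= d2.
  have -> : 2 * d = Num.min r (Num.min d1 d2) by rewrite mulrC divfK.
  by rewrite !ge_min !lexx !orbT.
clearbody d; pose M := `|M1 - v x + 1 + c * d ^+ 2| / d.
exists d, c, M; split=> //; first by rewrite divr_ge0// ltW.
  by move=> y yd; apply: rO; move: yd; rewrite /eball /=; lra.
move=> y p yd py; move: (yd); rewrite /eball /= => yd'.
have yr : eball x r y by rewrite /eball /=; lra.
have key z := semiconvex_le oO c0 rO scv yr (p := p) (z := z) ^~ py.
split; last by move=> z zd; apply: key; move: zd; rewrite /eball /=; lra.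
have [->|p0] := eqVneq (enorm p) 0; first by rewrite divr_ge0// ltW.
have p_gt0 : 0 < enorm p by rewrite lt_def p0 enorm_ge0.
pose h := (d / enorm p) *: p.
have hN : enorm h = d.
  by rewrite enormZ gtr0_norm ?divr_gt0// divfK.
have zx : enorm (y + h - x) < 2 * d.
  by have := enormD (y - x) h; rewrite addrAC hN; lra.
have := key (y + h); rewrite [_ + _ - y]addrAC subrr add0r hN dotvZr -sqr_enorm.
rewrite expr2 mulrA divfK// => /(_ (lt_le_trans zx dr)) H.
have ? := up _ (lt_le_trans zx dd1); have ? : v x - 1 < v y by apply: lo; lra.
have ? := ler_norm (M1 - v x + 1 + c * d ^+ 2).
rewrite /M ler_pdivlMr// mulrC; lra.
Qed.

(** Closed graph: subgradients at y near x are bounded, hence cluster at some p as y tends to x, and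
    their paraboloid bounds, uniform in c and d, pass to the limit. The set [C] carries any property
    of the approximating subgradients over to the closure. *)
Lemma Dminus_closure O v x (C : set 'rV[R]_n) :
  open O -> loc_semiconvex O v -> O x -> lsc_at v x ->
  (forall d : R, 0 < d ->
    exists y p, [/\ enorm (y - x) < d, Dminus O v y p & C p]) ->
  exists2 p, Dminus O v x p &
    forall e : R, 0 < e -> exists2 p', C p' & enorm (p' - p) < e.
Proof.
move=> oO scv Ox lx CP.
have [d [c [M [d0 c0 M0 dO H]]]] := Dminus_local oO scv Ox lx.
pose B r := [set p | C p /\ exists2 y, enorm (y - x) < r & Dminus O v y p].
have FF : ProperFilter (filter_from [set r : R | 0 < r] B).
  apply: filter_from_proper; last first.
    move=> r r0; have [y [p [yr py Cp]]] := CP r r0.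
    by exists p; split=> //; exists y.
  apply: filter_from_filter; first by exists 1 => /=.
  move=> r1 r2 /= r10 r20; exists (Num.min r1 r2).
    by rewrite /= lt_min r10.
  move=> p [Cp [y]]; rewrite lt_min => /andP[y1 y2] py.
  by split; split=> //; exists y.
have FM : filter_from [set r : R | 0 < r] B [set p | enorm (p - 0) <= M].
  by exists d => // p [_ [y yd py]] /=; rewrite subr0; case: (H y p yd py).
have [p _ pB] := eball_cluster FF FM.
exists p; last first.
  move=> e e0; have [|p' [Cp' _] pp'] := pB (B d) e _ e0; first by exists d.
  by exists p'.
apply: (@quad_le_Dminus _ _ _ _ c d) => // z zd.
set h := z - x; set N := enorm h.
have N0 : 0 <= N by exact: enorm_ge0.
apply/ler_addgt0Pr => e e0.
(* If p' and y are within t <= 1 of p and x, [t * K] bounds the total error: t N from replacing p'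
   by p, t M from moving the base point, and c t (2 N + 1) from the square. *)
pose K := N + M + c * (2 * N + 1).
have K0 : 0 <= K by rewrite !addr_ge0// mulr_ge0// addr_ge0// mulr_ge0.
have K1 : 0 < K + 1 by rewrite ltr_wpDl.
have e20 : 0 < e / 2 by rewrite divr_gt0.
have [dl dl0 lo] := (nbhs_enormP _ _).1 (lx _ e20).
pose t := Num.min 1 (e / 2 / (K + 1)).
have t0 : 0 < t by rewrite lt_min ltr01 divr_gt0.
have tK : t * K <= e / 2.
  apply: (@le_trans _ _ (t * (K + 1))); first by rewrite ler_pM2l// lerDl.
  by rewrite -ler_pdivlMr// ge_min lexx orbT.
have t1 : t <= 1 by rewrite ge_min lexx.
clearbody t; pose r := Num.min t (Num.min dl d).
have r0 : 0 < r by rewrite !lt_min t0 dl0.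
have [|p' [_ [y]]] := pB (B r) t _ t0; first by exists r.
rewrite !lt_min => /andP[yt /andP[yl yd]] py pp'.
have [p'M /(_ z zd) Hz] := H y p' yd py.
have vy := lo y yl.
have zy : z - y = h + (x - y) by rewrite /h addrA subrK.
have kt : enorm (x - y) < t by rewrite enormB.
have k0 := enorm_ge0 (x - y).
have zyN : enorm (z - y) ^+ 2 <= N ^+ 2 + t * (2 * N + 1).
  apply: (@le_trans _ _ ((N + t) ^+ 2)).
    rewrite ler_pXn2r ?nnegrE ?enorm_ge0 ?addr_ge0 ?(ltW t0)//.
    by rewrite zy; apply: le_trans (enormD _ _) _; rewrite lerD2l ltW.
  by have : t * t <= t by [rewrite ler_piMr// ltW]; rewrite sqrrD; lra.
have : c * enorm (z - y) ^+ 2 <= c * (N ^+ 2 + t * (2 * N + 1)).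
  by rewrite ler_wpM2l.
have : - (t * N) <= dotv (p' - p) h.
  have := norm_dotv_le (p' - p) h; rewrite ler_norml => /andP[+ _].
  have : enorm (p' - p) * N <= t * N by rewrite ler_wpM2r// ltW.
  rewrite -/N; lra.
have : - (t * M) <= dotv p' (x - y).
  have := norm_dotv_le p' (x - y); rewrite ler_norml => /andP[+ _].
  have : enorm p' * enorm (x - y) <= M * t by rewrite ler_pM ?enorm_ge0// ltW.
  lra.
move: Hz tK; rewrite zy dotvDr /K -zy dotvBl.
by rewrite !mulrDr; lra.
Qed.

(** An interior minimum y of v + N |. - x|^2 on a small ball provides a subgradient at y. Such y
    exist arbitrarily near x, and the closed graph gives one at x. *)
Lemma Dminus_nonempty O v x : open O -> loc_semiconvex O v ->
  (forall y, O y -> lsc_at v y) -> O x -> exists p, Dminus O v x p.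
Proof.
move=> oO scv lv Ox; have lx := lv x Ox.
suff /(Dminus_closure oO scv Ox lx)[p Dp _] : forall d : R, 0 < d ->
  exists y p, [/\ enorm (y - x) < d, Dminus O v y p & setT p] by exists p.
move=> d d0; have [d1 d10 dO] := open_eball oO Ox.
have [d2 d20 lo] := (nbhs_enormP _ _).1 (lx _ ltr01).
pose r := Num.min d (Num.min d1 d2) / 2.
have r0 : 0 < r by rewrite divr_gt0// !lt_min d0 d10.
have [rd [rd1 rd2]] : 2 * r <= d /\ 2 * r <= d1 /\ 2 * r <= d2.
  have -> : 2 * r = Num.min d (Num.min d1 d2) by rewrite mulrC divfK.
  by rewrite !ge_min !lexx !orbT.
(* The penalty is 1 on the sphere of radius r, while v > v x - 1 on the closed ball; hence the
   minimum is not on the sphere. *)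
pose N := r ^- 2.
have N0 : 0 < N by rewrite invr_gt0 exprn_gt0.
have sqE y z : enorm (z - x) ^+ 2 =
    enorm (y - x) ^+ 2 + 2 * dotv (y - x) (z - y) + enorm (z - y) ^+ 2.
  have -> : z - x = (y - x) + (z - y) by rewrite [RHS]addrC addrA subrK.
  move: (y - x) (z - y) => a b.
  by rewrite !sqr_enorm dotvDl !dotvDr (dotvC b a); ring.
have [||y yr ymin] :=
  @lsc_min_eball _ _ (fun y => v y + N * enorm (y - x) ^+ 2) x r.
- exact: ltW.
- move=> y yr e e0.
  (* The penalised function is lower semicontinuous: v is, and the expansion [sqE] controls the
     change of the penalty. *)
  have Oy : O y by apply: dO; lra.
  have e20 : 0 < e / 2 by rewrite divr_gt0.
  have [d3 d30 d3P] := (nbhs_enormP _ _).1 (lv y Oy _ e20).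
  pose K := N * (2 * enorm (y - x)).
  have K1 : 0 < K + 1 by rewrite ltr_wpDl// !mulr_ge0 ?enorm_ge0// ltW.
  apply/nbhs_enormP; exists (Num.min d3 (e / 2 / (K + 1))).
    by rewrite lt_min d30 divr_gt0.
  move=> z; rewrite lt_min ltr_pdivlMr// => /andP[zd3 ze].
  have := d3P z zd3; rewrite (sqE y z).
  have : - (enorm (y - x) * enorm (z - y)) <= dotv (y - x) (z - y).
    by have := norm_dotv_le (y - x) (z - y); rewrite ler_norml => /andP[+ _].
  move=> H1 H2; have := enorm_ge0 (z - y).
  have : N * (- (2 * enorm (y - x) * enorm (z - y))) <=
         N * (2 * dotv (y - x) (z - y) + enorm (z - y) ^+ 2).
    by rewrite ler_pM2l//; have := sqr_ge0 (enorm (z - y)); lra.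
  by move: ze; rewrite /K; lra.
have := ymin x; rewrite subrr enorm0 expr0n mulr0 addr0 => /(_ (ltW r0)) yx.
have vy := lo y ltac:(lra).
have yr' : enorm (y - x) < r.
  rewrite -(@ltr_pXn2r _ 2) ?nnegrE ?enorm_ge0 ?(ltW r0)//.
  rewrite -[ltRHS]mulr1 -ltr_pdivrMl ?exprn_gt0// -/N; lra.
(* This is the gradient at y of - N |. - x|^2, which touches v from below at y up to a constant. *)
exists y, (- (2 * N) *: (y - x)); split=> //; first by lra.
apply: (@quad_le_Dminus _ _ _ _ N (r - enorm (y - x))).
  by rewrite subr_gt0.
move=> z zy; have := ymin z; rewrite (sqE y z) dotvZl.
have := enorm_triangle z y x => ? /(_ ltac:(lra)).
by rewrite !mulrDr; lra.
Qed.

End Semiconvex.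

(** * Projected subgradients and differentiability along a subspace *)

Section Projection.
Variables (R : realType) (n : nat).
Implicit Types (u w x y z p q : 'rV[R]_n) (O S : set 'rV[R]_n) (P M : 'M[R]_n)
  (v : 'rV[R]_n -> R).

Lemma dotv_proj S u q s : is_proj S u q -> S s -> dotv q s = dotv u s.
Proof. by case=> _ /[apply] /eqP; rewrite dotvBl subr_eq0 => /eqP. Qed.

(** Both expansions at x + t w, with w = q1 - q2 in S and tolerance |w| / 4, would give t |w|^2 <= t
    |w|^2 / 2. *)
Lemma Dsub_uniq S O v x q1 q2 : open O -> O x -> lin_subspace S ->
  Dsub S O v x q1 -> Dsub S O v x q2 -> q1 = q2.
Proof.
move=> oO Ox lS [S1 D1] [S2 D2]; set w := q1 - q2.
have Sw : S w by exact: lin_subspaceB.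
apply/eqP; rewrite -subr_eq0 -/w; apply/negPn/negP => w0.
have N0 : 0 < enorm w.
  by rewrite lt_def enorm_ge0 andbT; apply: contra w0 => /eqP/enorm_eq0 ->.
have e0 : 0 < enorm w / 4 by rewrite divr_gt0.
have [d1 d10 H1] := (nbhs_enormP _ _).1 (D1 _ e0).
have [d2 d20 H2] := (nbhs_enormP _ _).1 (D2 _ e0).
have [d3 d30 H3] := open_eball oO Ox.
pose d := Num.min d1 (Num.min d2 d3).
have d0 : 0 < d by rewrite !lt_min d10 d20.
pose t := d / 2 / enorm w.
have t0 : 0 < t by rewrite !divr_gt0.
have yx : x + t *: w - x = t *: w by rewrite addrAC subrr add0r.
have yd : enorm (x + t *: w - x) < d.
  rewrite yx enormZ gtr0_norm// /t divfK ?gt_eqF// ltr_pdivrMr//.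
  by rewrite ltr_pMr// ltr1n.
have Sy : S (x + t *: w - x) by rewrite yx; case: lS => _ [_]; apply.
move: (yd); rewrite !lt_min => /and3P[y1 y2 y3].
have := H1 _ y1 (H3 _ y3) Sy; have := H2 _ y2 (H3 _ y3) Sy.
rewrite yx enormZ (gtr0_norm t0) !dotvZr !ler_norml.
move=> /andP[A1 A2] /andP[B1 B2].
have : t * dotv w w <= t * (enorm w ^+ 2 / 2).
  by rewrite {1}/w dotvBl; lra.
by rewrite ler_pM2l// -sqr_enorm; have := exprn_gt0 2 N0; lra.
Qed.

Lemma proj_eq_of_orth S P p1 p2 : lin_subspace S ->
  (forall u, is_proj S u (u *m P)) ->
  (forall s, S s -> dotv (p1 - p2) s = 0) -> p1 *m P = p2 *m P.
Proof.
move=> lS SP o; apply: (is_proj_uniq lS (SP p1)); split=> [|s Ss].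
  by case: (SP p2).
have := o s Ss; have := dotv_proj (SP p2) Ss; rewrite !dotvBl; lra.
Qed.

(** Otherwise subgradients at points tending to x have projections at distance at least e from q. A
    limit of them lies in D^-v(x), so it projects to q, which contradicts the continuity of
    multiplication by P. *)
Lemma Dminus_proj_usc O v x P q :
  open O -> loc_semiconvex O v -> O x -> lsc_at v x ->
  (forall p, Dminus O v x p -> p *m P = q) ->
  forall e : R, 0 < e -> exists2 d : R, 0 < d &
    forall y p, enorm (y - x) < d -> Dminus O v y p -> enorm (p *m P - q) < e.
Proof.
move=> oO scv Ox lx Pq e e0; apply: contrapT => Hn.
pose C := [set p | e <= enorm (p *m P - q)].
have [|p Dp pC] := Dminus_closure (C := C) oO scv Ox lx.
  move=> d d0; apply: contrapT => Hd; apply: Hn; exists d => // y p yx py.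
  by rewrite ltNge; apply/negP => pe; apply: Hd; exists y, p.
pose K := n.+1%:R ^+ 2 * `|P|.
have K0 : 0 <= K by rewrite mulr_ge0// sqr_ge0.
have K1 : 0 < K + 1 by rewrite ltr_wpDl.
have [p' + p'p] := pC (e / (K + 1)) (divr_gt0 e0 K1).
rewrite /C /= -(Pq p Dp) -mulmxBl leNgt => /negP; apply.
apply: le_lt_trans (enorm_mulmx_le _ _) _; rewrite -/K.
apply: (@le_lt_trans _ _ ((K + 1) * enorm (p' - p))).
  by rewrite ler_wpM2r ?enorm_ge0// lerDl.
by rewrite mulrC -ltr_pdivlMr.
Qed.

(** The paraboloid at x bounds v y - v x from below; the one at y, evaluated at x, bounds it from
    above. Along S only the projections of the two subgradients matter, and these are close. *)
Lemma Dsub_proj O S v x P p :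
  open O -> loc_semiconvex O v -> (forall y, O y -> lsc_at v y) -> O x ->
  (forall u, is_proj S u (u *m P)) ->
  (forall p', Dminus O v x p' -> p' *m P = p *m P) ->
  Dminus O v x p -> Dsub S O v x (p *m P).
Proof.
move=> oO scv lv Ox SP Pq Dp; split; first by case: (SP p).
move=> e e0; have lx := lv x Ox.
have e20 : 0 < e / 2 by rewrite divr_gt0.
have [d1 d10 usc] := Dminus_proj_usc oO scv Ox lx Pq e20.
have [d2 [c [M [d20 c0 M0 dO H]]]] := Dminus_local oO scv Ox lx.
have c1 : 0 < c + 1 by rewrite ltr_wpDl.
apply/nbhs_enormP; exists (Num.min d1 (Num.min d2 (e / 2 / (c + 1)))).
  by rewrite !lt_min d10 d20 !divr_gt0.
move=> y; rewrite !lt_min ltr_pdivlMr// => /and3P[y1 y2 y3] Oy Sy.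
have xd : eball x d2 x by rewrite /eball /= subrr enorm0.
have [_ /(_ y y2) Hx] := H x p xd Dp.
have [py Dpy] := Dminus_nonempty oO scv lv Oy.
have [_ /(_ x xd) Hy] := H y py y2 Dpy.
have := usc y py y1 Dpy => U.
have yx0 := enorm_ge0 (y - x).
have c2 : c * enorm (y - x) ^+ 2 <= e / 2 * enorm (y - x).
  by rewrite expr2 mulrA ler_wpM2r//; lra.
have B : dotv (py *m P - p *m P) (y - x) <= e / 2 * enorm (y - x).
  by apply: le_trans (dotv_le_enorm _ _) _; rewrite ler_wpM2r// ltW.
move: B Hy; rewrite (enormB x y) -(opprB y x) dotvNr.
rewrite dotvBl !(dotv_proj (SP _) Sy) => B Hy.
by rewrite ler_norml; apply/andP; split; lra.
Qed.

End Projection.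

(** * Consequences of the supersolution property *)

Section Viscosity.
Variables (R : realType) (n m : nat) (A : Type).
Variables (sigma : 'rV[R]_n -> A -> 'M[R]_(n, m))
  (beta : 'rV[R]_n -> A -> 'rV[R]_n) (g rho : 'rV[R]_n -> A -> R).
Implicit Types (x y p : 'rV[R]_n) (O : set 'rV[R]_n) (v : 'rV[R]_n -> R).

Lemma lin_subspace_Rspan x : lin_subspace (Rspan sigma x).
Proof.
split.
  exists 0%N, (fun i : 'I_0 => False_rect A (notF (ltn_ord i))), (fun=> 0).
  by rewrite big_ord0.
split=> [_ _ [k1 [a1 [w1 ->]]] [k2 [a2 [w2 ->]]]|c _ [k [a [w ->]]]].
  pose join T (f1 : 'I_k1 -> T) (f2 : 'I_k2 -> T) (i : 'I_(k1 + k2)) :=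
    match fintype.split i with inl j => f1 j | inr j => f2 j end.
  exists (k1 + k2)%N, (join _ a1 a2), (join _ w1 w2).
  rewrite big_split_ord /=; congr (_ + _); apply: eq_bigr => i _.
    by rewrite /join (unsplitK (inl i)).
  by rewrite /join (unsplitK (inr i)).
exists k, a, (fun i => c *: w i); rewrite scaler_sumr.
by apply: eq_bigr => i _; rewrite scalemxAl.
Qed.

(** Symmetry of M merges the two cross terms into the gradient, which leaves <k M, k> / 2 as
    first-order remainder; the gradient is affine, so its own remainder vanishes. *)
Lemma quadratic_C2 O x (a : R) p (M : 'M[R]_n) : M^T = M ->
  C2_with O (fun y => a + dotv p (y - x) + 2^-1 * dotv ((y - x) *m M) (y - x))
    (fun y => p + (y - x) *m M) (fun=> M).
Proof.
move=> MT; split; last by move=> y; exact: cvg_cst.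
move=> y _; split=> e e0; last first.
  apply/nbhs_enormP; exists 1 => // z _.
  rewrite opprD addrACA subrr add0r -mulmxBl opprB addrA subrK subrr enorm0.
  by rewrite mulr_ge0 ?enorm_ge0// ltW.
pose K := n.+1%:R ^+ 2 * `|M|.
have K0 : 0 <= K by rewrite mulr_ge0// sqr_ge0.
have K1 : 0 < K + 1 by rewrite ltr_wpDl.
apply/nbhs_enormP; exists (e / (K + 1)); first by rewrite divr_gt0.
move=> z; rewrite ltr_pdivlMr//.
have -> : z - x = (y - x) + (z - y) by rewrite [RHS]addrC addrA subrK.
move: (y - x) (z - y) => h k kK; set X := `|_|.
have -> : X = 2^-1 * `|dotv (k *m M) k|.
  have kh : dotv (k *m M) h = dotv (h *m M) k.
    rewrite (dotvC (h *m M)) /dotv trmx_mul MT.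
    by rewrite mulmxA.
  rewrite -[2^-1]ger0_norm ?invr_ge0// -normrM; congr (`|_|).
  by rewrite mulmxDl !(dotvDl, dotvDr) kh; field.
have N0 := enorm_ge0 k.
have : `|dotv (k *m M) k| <= (K * enorm k) * enorm k.
  apply: le_trans (norm_dotv_le _ _) _.
  by rewrite ler_wpM2r// enorm_mulmx_le.
have : (K * enorm k) * enorm k <= e * enorm k by rewrite ler_wpM2r//; lra.
have := normr_ge0 (dotv (k *m M) k); lra.
Qed.

(* Halving the segment [p1, p2], the maximum of the two supporting paraboloids
   is v x + <p, h> + |<q, h>| - c |h|^2, which lies above the smooth function
   with N <q, h>^2 in place of |<q, h>| wherever N |<q, h>| <= 1; letting
   N tend to infinity in the supersolution inequality forces q sigma = 0. *)
Lemma Dminus_sub_sigma O v x a p1 p2 : open O -> loc_semiconvex O v -> O x ->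
  visc_super_at sigma beta g rho O v x ->
  Dminus O v x p1 -> Dminus O v x p2 -> (p1 - p2) *m sigma x a = 0.
Proof.
move=> oO scv Ox [lx visc] D1 D2.
have [d [c [K [d0 c0 K0 dO H]]]] := Dminus_local oO scv Ox lx.
have xd : eball x d x by rewrite /eball /= subrr enorm0.
have [_ {}D1] := H x p1 xd D1; have [_ {}D2] := H x p2 xd D2.
pose p := 2^-1 *: (p1 + p2); pose q := 2^-1 *: (p1 - p2).
have p1E : p1 = p + q by apply/rowP => i; rewrite !mxE; field.
have p2E : p2 = p - q by apply/rowP => i; rewrite !mxE; field.
have -> : p1 - p2 = 2 *: q by rewrite scalerA mulfV// scale1r.
rewrite -scalemxAl; apply/eqP; rewrite scaler_eq0 pnatr_eq0/=; apply/eqP.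
clearbody p q; rewrite p1E p2E {p1 p2 p1E p2E} in D1 D2.
(* Hessian of the test function h |-> v x + <p, h> + N <q, h>^2 - c |h|^2. *)
pose M (N : R) := (2 * N) *: (q^T *m q) - (2 * c)%:M.
have MT N : (M N)^T = M N.
  by rewrite /M linearB linearZ /= trmx_mul trmxK tr_scalar_mx.
have ME N h : 2^-1 * dotv (h *m M N) h = N * dotv q h ^+ 2 - c * enorm h ^+ 2.
  rewrite mulmxBr dotvBl -scalemxAr dotvZl mulmxA.
  rewrite (mx11_scalar (h *m q^T)) mul_scalar_mx -/(dotv h q) dotvZl.
  by rewrite mul_mx_scalar dotvZl sqr_enorm (dotvC h q); field.
have key N : 0 <= N -> Lag sigma beta g rho a x (v x) p (M N) <= 0.
  move=> N0; have := visc _ _ _ (quadratic_C2 O x (v x) p (MT N)).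
  rewrite subrr mul0mx addr0 oppe_ge0 => visc'.
  rewrite -lee_fin; apply: le_trans (visc' _).
    by apply: ereal_sup_ubound; exists a.
  apply/nbhs_enormP.
  have Nq : 0 < N * enorm q + 1 by rewrite ltr_wpDl// mulr_ge0 ?enorm_ge0.
  (* Within this radius N |<q, h>| <= 1, hence N <q, h>^2 <= |<q, h>|. *)
  exists (Num.min d (N * enorm q + 1)^-1); first by rewrite lt_min d0 invr_gt0.
  move=> y; rewrite lt_min => /andP[yd yN].
  rewrite !ME subrr dotv0r enorm0 dotv0r !expr0n !mulr0 subrr !addr0 subrr.
  have := D1 y yd; have := D2 y yd; rewrite !dotvDl dotvNl.
  move: (y - x) yN => h hN.
  have : N * `|dotv q h| <= 1.
    apply: (@le_trans _ _ (N * (enorm q * enorm h))).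
      by rewrite ler_wpM2l// norm_dotv_le.
    move: hN; rewrite -[_^-1]mul1r ltr_pdivlMr// => hN.
    by have := enorm_ge0 h; lra.
  have -> : N * dotv q h ^+ 2 = N * `|dotv q h| * `|dotv q h|.
    by rewrite -mulrA -expr2 real_normK ?num_real.
  move=> N1; have : N * `|dotv q h| * `|dotv q h| <= `|dotv q h|.
    by rewrite ler_piMl.
  by have [q0|q0] := ger0P (dotv q h); lra.
apply: enorm_eq0; apply/eqP; rewrite -sqrf_eq0 sqr_enorm.
set T := dotv _ _; have T0 : 0 <= T by exact: dotvv_ge0.
have trE N : \tr (sigma x a *m (sigma x a)^T *m M N) =
    2 * N * T - 2 * c * \tr (sigma x a *m (sigma x a)^T).
  rewrite /M mulmxBr linearB /= -scalemxAr linearZ /= mul_mx_scalar linearZ /=.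
  congr (_ * _ - _).
  by rewrite mulmxA mxtrace_mulC !mulmxA -mulmxA -trmx_mul trace_mx11.
apply/negPn/negP => Tn0; have {Tn0}T0 : 0 < T by rewrite lt_def Tn0.
pose L0 := Lag sigma beta g rho a x (v x) p (M 0).
have LE N : Lag sigma beta g rho a x (v x) p (M N) = L0 + N * T.
  by rewrite /L0 /Lag !trE; field.
(* The Lagrangian is affine in N with slope T = |q sigma|^2; at this N it equals L0 + |L0| + 1 >
   0. *)
have := key ((`|L0| + 1) / T); rewrite LE divfK ?gt_eqF//.
rewrite divr_ge0 ?addr_ge0 ?(ltW T0)// => /(_ isT).
have := ler_norm (- L0); rewrite normrN; lra.
Qed.

(** Pairing p1 - p2 with w sigma^T amounts to pairing (p1 - p2) sigma = 0 with w. *)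
Lemma Dminus_orth_Rspan O v x p1 p2 u : open O -> loc_semiconvex O v -> O x ->
  visc_super_at sigma beta g rho O v x ->
  Dminus O v x p1 -> Dminus O v x p2 -> Rspan sigma x u ->
  dotv (p1 - p2) u = 0.
Proof.
move=> oO scv Ox visc D1 D2 [k [a [w ->]]].
rewrite /dotv linear_sum mulmx_sumr summxE; apply: big1 => i _ /=.
rewrite trmx_mul trmxK mulmxA (Dminus_sub_sigma _ oO scv Ox visc)//.
by rewrite mul0mx mxE.
Qed.

End Viscosity.

(** * Differentiability along subspaces of R(x) and continuity of the derivative *)

Section Main.
Variables (R : realType) (n m : nat) (A : Type).
Variables (sigma : 'rV[R]_n -> A -> 'M[R]_(n, m))
  (beta : 'rV[R]_n -> A -> 'rV[R]_n) (g rho : 'rV[R]_n -> A -> R)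
  (O : set 'rV[R]_n) (v : 'rV[R]_n -> R).

Lemma Dsub_proj_Rspan (S : set 'rV[R]_n) (P : 'M[R]_n) x p :
  open O -> loc_semiconvex O v ->
  (forall y, O y -> visc_super_at sigma beta g rho O v y) -> O x ->
  lin_subspace S -> S `<=` Rspan sigma x ->
  (forall u, is_proj S u (u *m P)) ->
  Dminus O v x p ->
  Dsub S O v x = [set p *m P] /\
    forall p', Dminus O v x p' -> p' *m P = p *m P.
Proof.
move=> oO scv visc Ox lS SR SP Dp.
have Pq p' : Dminus O v x p' -> p' *m P = p *m P.
  move=> Dp'; apply: (proj_eq_of_orth lS SP) => s /SR.
  exact: (Dminus_orth_Rspan oO scv Ox (visc x Ox)).
split=> //; have lv y (Oy : O y) := (visc y Oy).1.
have Dq := Dsub_proj oO scv lv Ox SP Pq Dp.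
apply/seteqP; split=> [q Dq'|_ ->//]; exact: (Dsub_uniq oO Ox lS Dq' Dq).
Qed.

(** Write p_y P_y - p_x P_x = p_y (P_y - P_x) + (p_y P_x - p_x P_x). The first term is small since
    subgradients are locally bounded and P is continuous, the second by semicontinuity of projected
    subgradients for the fixed matrix P_x. *)
Lemma Dsub_continuous (D : set 'rV[R]_n) (S : 'rV[R]_n -> set 'rV[R]_n)
    (P : 'rV[R]_n -> 'M[R]_n) :
  open O -> loc_semiconvex O v ->
  (forall y, O y -> visc_super_at sigma beta g rho O v y) ->
  open D -> D `<=` O ->
  (forall x, D x -> lin_subspace (S x) /\ S x `<=` Rspan sigma x) ->
  (forall x, D x -> forall u, is_proj (S x) u (u *m P x)) ->
  {within D, continuous P} ->
  exists DSv : 'rV[R]_n -> 'rV[R]_n,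
    (forall x, D x -> Dsub (S x) O v x = [set DSv x]) /\
    {within D, continuous DSv}.
Proof.
move=> oO scv visc oD DO lS SP.
rewrite continuous_open_subspace// => cP.
have lv y (Oy : O y) := (visc y Oy).1.
(* An arbitrary selection of subgradients, with junk value 0 outside O; on D its projection does not
   depend on the choice. *)
have /choice[p pP] : forall x, exists p, O x -> Dminus O v x p.
  move=> x; have [Ox|nOx] := pselect (O x); last by exists 0.
  by have [p Dp] := Dminus_nonempty oO scv lv Ox; exists p.
have DE x (Dx : D x) := Dsub_proj_Rspan oO scv visc (DO x Dx) (lS x Dx).1
  (lS x Dx).2 (SP x Dx) (pP x (DO x Dx)).
exists (fun x => p x *m P x); split=> [x Dx|]; first by case: (DE x Dx).
rewrite continuous_open_subspace// => x /set_mem Dx.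
have Ox := DO x Dx; have [_ Pq] := DE x Dx.
have [d1 [c [M [d10 c0 M0 dO H]]]] := Dminus_local oO scv Ox (lv x Ox).
move=> B /nbhs_enormP[e e0 eB].
have e20 : 0 < e / 2 by rewrite divr_gt0.
have [d2 d20 usc] := Dminus_proj_usc oO scv Ox (lv x Ox) Pq e20.
pose K : R := n.+1%:R ^+ 2 * M.
have K0 : 0 <= K by rewrite mulr_ge0// sqr_ge0.
have K1 : 0 < K + 1 by rewrite ltr_wpDl.
(* As [K] bounds n.+1^2 |p_y|, this radius keeps p_y (P_y - P_x) below e / 2. *)
have PB : nbhs (P x) (ball (P x) (e / 2 / (K + 1))).
  by apply: nbhsx_ballx; rewrite divr_gt0.
have [d3 d30 dP] := (nbhs_enormP _ _).1 (cP x (mem_set Dx) _ PB).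
have [d4 d40 dD] := open_eball oD Dx.
apply/nbhs_enormP; exists (Num.min (Num.min d1 d2) (Num.min d3 d4)).
  by rewrite !lt_min d10 d20 d30.
move=> y; rewrite !lt_min => /andP[/andP[y1 y2] /andP[y3 y4]].
have Dpy := pP y (DO y (dD y y4)).
apply: eB.
have := enorm_triangle (p y *m P y) (p y *m P x) (p x *m P x).
have := usc y (p y) y2 Dpy.
have := enorm_mulmx_le (p y) (P y - P x); rewrite mulmxBr.
have [pM _] := H y (p y) y1 Dpy.
have := dP y y3; rewrite -ball_normE /= distrC ltr_pdivlMr// => Pe.
have : n.+1%:R ^+ 2 * `|P y - P x| * enorm (p y) <= `|P y - P x| * K.
  by rewrite /K [leRHS]mulrCA [leRHS]mulrA ler_wpM2l ?mulr_ge0 ?sqr_ge0//.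
have := normr_ge0 (P y - P x).
lra.
Qed.

End Main.

Theorem theorem2p1 (R : realType) (n m : nat) (A : Type)
  (O : set 'rV[R]_n)
  (sigma : 'rV[R]_n -> A -> 'M[R]_(n, m)) (beta : 'rV[R]_n -> A -> 'rV[R]_n)
  (g rho : 'rV[R]_n -> A -> R) (v : 'rV[R]_n -> R) :
  inhabited A -> open O ->
  loc_semiconvex O v ->
  (forall x, O x -> visc_super_at sigma beta g rho O v x) ->
  (* (i) *)
  (forall x, O x -> Rspan sigma x <> [set 0] ->
     Dsub (Rspan sigma x) O v x <> set0 /\
     Dsub (Rspan sigma x) O v x =
       [set q | exists p, Dminus O v x p /\ is_proj (Rspan sigma x) p q])
  /\
  (* (ii) *)
  (forall (D : set 'rV[R]_n) (S : 'rV[R]_n -> set 'rV[R]_n),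
     open D -> D `<=` O ->
     (forall x, D x -> lin_subspace (S x) /\ nontrivial (S x) /\
                       S x `<=` Rspan sigma x) ->
     (exists Pm : 'rV[R]_n -> 'M[R]_n,
        (forall x, D x -> forall u, is_proj (S x) u (u *m Pm x)) /\
        {within D, continuous Pm}) ->
     exists DSv : 'rV[R]_n -> 'rV[R]_n,
       (forall x, D x -> Dsub (S x) O v x = [set DSv x]) /\
       {within D, continuous DSv})
  /\
  (* (ii), "in particular" *)
  (forall D : set 'rV[R]_n, open D -> D `<=` O ->
     (forall x, D x -> Rspan sigma x = setT) -> C1_on D v).
Proof.
move=> _ oO scv visc.
have lv y (Oy : O y) := (visc y Oy).1.
split; [|split].
- move=> x Ox _; have lR := lin_subspace_Rspan sigma x.
  have [P RP] := lin_subspace_proj lR.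
  have [p Dp] := Dminus_nonempty oO scv lv Ox.
  have [-> Pq] := Dsub_proj_Rspan oO scv visc Ox lR (@subset_refl _ _) RP Dp.
  split; first by apply/eqP/set0P; exists (p *m P).
  apply/seteqP; split=> [_ ->|q [p' [Dp' pq]]]; first by exists p.
  by rewrite /= -(Pq p' Dp'); exact: (is_proj_uniq lR pq).
- move=> D S oD DO SR [P [SP cP]].
  by apply: (Dsub_continuous oO scv visc oD DO _ SP cP) => x /SR[? []].
- move=> D oD DO RT.
  (* The whole space as S, with the identity as its constant projection. *)
  have [|||Df [DfE cDf]] := Dsub_continuous (S := fun=> setT) (P := fun=> 1%:M)
    oO scv visc oD DO.
  + by move=> x Dx; rewrite RT.
  + by move=> x Dx u; split=> // s _; rewrite mulmx1 subrr dotv0l.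
  + by move=> x; exact: cvg_cst.
  exists Df; split=> // x Dx e e0; have [_ /(_ e e0)] : Dsub setT O v x (Df x).
    by rewrite DfE.
  (* [Dsub] tests only y in O, [has_grad] all y near x; they agree because O is open. *)
  have : \forall y \near x, O y by apply: open_nbhs_nbhs; split=> //; exact: DO.
  by apply: filterS2 => y Oy; apply.
Qed.
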